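(* For each continuous map $f:X\to X'$ of compact metric spaces, the corresponding homological sequence $$\cdots\to\bar{\mathbf{H}}_n(X')\overset{\sigma_*}{\longrightarrow}\bar{\mathbf{H}}_n(f)\overset{\partial_*}{\longrightarrow}\bar{\mathbf{H}}_{n-1}(X)\overset{E}{\longrightarrow}\bar{\mathbf{H}}_{n-1}(X')\to\cdots$$ is exact.
   Context: Morphisms of maps. A morphism $(\varphi,\varphi'):f\to g$ from $f:X\to X'$ to $g:Y\to Y'$ is a pair of continuous maps $\varphi:X\to Y$, $\varphi':X'\to Y'$ with $g\varphi=\varphi'f$. A homotopy of two morphisms $f\to g$ is a morphism $f\times 1_I\to g$, $I=[0,1]$, restricting to them at $0$ and $1$. An ANR-map is a continuous map between ANRs (absolute neighbourhood retracts for metric spaces). Inverse sequences. $\mathbf{f}=\{f_i,(p_{i,i+1},p'_{i,i+1}),\mathbb{N}\}:\mathbf{X}\to\mathbf{X}'$ consists of continuous maps $f_i:X_i\to X'_i$ and morphisms $(p_{i,i+1},p'_{i,i+1}):f_{i+1}\to f_i$; $\mathbf{X}=\{X_i,p_{i,i+1},\mathbb{N}\}$, $\mathbf{X}'=\{X'_i,p'_{i,i+1},\mathbb{N}\}$; for $i\le j$, $p_{i,j}$, $p'_{i,j}$ are the composites of bonding maps. It is an inverse ANR-sequence if all $X_i,X'_i$ are compact metric ANRs. Strong ANR-expansion. A strong ANR-expansion $(\mathbf{p},\mathbf{p}'):f\to\mathbf{f}$ of a map $f$ of compact metric spaces is an inverse ANR-sequence $\mathbf{f}$ with morphisms $(p_i,p'_i):f\to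 f_i$ satisfying $p_{i,i+1}p_{i+1}=p_i$, $p'_{i,i+1}p'_{i+1}=p'_i$, such that for every ANR-map $q$: (SE1) every morphism $f\to q$ is homotopic to $(h,h')\circ(p_i,p'_i)$ for some $i$ and some morphism $(h,h'):f_i\to q$; (SE2) if $(h_0,h'_0),(h_1,h'_1):f_i\to q$ are morphisms and $(F,F'):f\times 1_I\to q$ is a homotopy from $(h_0,h'_0)(p_i,p'_i)$ to $(h_1,h'_1)(p_i,p'_i)$, then there are $j\ge i$ and a homotopy $(G,G'):f_j\times 1_I\to q$ from $(h_0,h'_0)(p_{i,j},p'_{i,j})$ to $(h_1,h'_1)(p_{i,j},p'_{i,j})$ such that $(G,G')\circ((p_j,p'_j)\times 1_I)$ is homotopic to $(F,F')$ relative to $f\times 1_{\{0,1\}}$. Every continuous map of compact metric spaces has a strong ANR-expansion. Chain complexes. $S_*$ is the singular chain complex; $f_i^{\#},p_{i,i+1}^{\#},p_{i,i+1}'^{\#}$ are the induced chain maps. For a chain map $h:L_*\to M_*$, the chain cone $C_*(h)$ has $C_n(h)=L_{n-1}\oplus M_n$ with differential $(l,m)\mapsto(\partial l,-\partial m+h(l))$. Put $K_n(\mathbf{X})=\prod_iS_n(X_i)$, $K_n(\mathbf{X}')=\prod_iS_n(X'_i)$, $K_n(\mathbf{f})=\prod_iC_n(f_i^{\#})$, with componentwise differentials. The chain maps $\mathbf{p}_{\#}$, $\mathbf{p}'_{\#}$, $(\mathbf{p}_{\#},\mathbf{p}'_{\#})$ of $K_*(\mathbf{X})$, $K_*(\mathbf{X}')$,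 $K_*(\mathbf{f})$ to themselves are $\{c_i\}\mapsto\{p_{i,i+1}^{\#}(c_{i+1})-c_i\}$, $\{c'_i\}\mapsto\{p_{i,i+1}'^{\#}(c'_{i+1})-c'_i\}$, $\{(c_i,c'_i)\}\mapsto\{(p_{i,i+1}^{\#}(c_{i+1})-c_i,\;p_{i,i+1}'^{\#}(c'_{i+1})-c'_i)\}$. Their chain cones are $C_*(\mathbf{p}_{\#})$, $C_*(\mathbf{p}'_{\#})$, $C_*(\mathbf{p}_{\#},\mathbf{p}'_{\#})$. Strong homology. Fix a strong ANR-expansion $\mathbf{f}$ of $f$. The strong homology groups are $$\bar{\mathbf{H}}_n(X)=H_{n+1}(C_*(\mathbf{p}_{\#})),\quad \bar{\mathbf{H}}_n(X')=H_{n+1}(C_*(\mathbf{p}'_{\#})),\quad \bar{\mathbf{H}}_n(f)=H_{n+1}(C_*(\mathbf{p}_{\#},\mathbf{p}'_{\#}));$$ up to isomorphism they do not depend on the choice of the expansion. The homomorphisms $\sigma_*$ and $\partial_*$ are those induced by the maps $$\sigma:C_n(\mathbf{p}'_{\#})\to C_n(\mathbf{p}_{\#},\mathbf{p}'_{\#}),\quad \sigma(\{c_i'^{\,n-1}\},\{c_i'^{\,n}\})=(\{(0,c_i'^{\,n-1})\},\{(0,c_i'^{\,n})\}),$$ $$\partial:C_n(\mathbf{p}_{\#},\mathbf{p}'_{\#})\to C_{n-1}(\mathbf{p}_{\#}),\quad \partial(\{(c_i^{n-2},c_i'^{\,n-1})\},\{(c_i^{n-1},c_i'^{\,n})\})=(\{c_i^{n-2}\},\{c_i^{n-1}\}),$$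 and $E$ is the connecting homomorphism of the short exact sequence $0\to C_*(\mathbf{p}'_{\#})\overset{\sigma}{\to}C_*(\mathbf{p}_{\#},\mathbf{p}'_{\#})\overset{\partial}{\to}C_*(\mathbf{p}_{\#})\to0$, in which $\partial$ lowers degree by one.
   Formalization: The map σ is taken with a minus sign in its second component, σ({c'^{n-1}},{c'^n}) = ({(0,c'^{n-1})},{(0,-c'^n)}), since with the stated cone differentials the printed σ does not send cycles to cycles, so σ_* and E would be undefined. *)

(* Defs.v *)
From HB Require Import structures.
From mathcomp Require Import all_boot all_order all_algebra.
From mathcomp Require Import boolp classical_sets functions reals topology.
From mathcomp Require Import freeg zify.

Set Implicit Arguments.
Unset Strict Implicit.
Unset Printing Implicit Defensive.

Import Order.TTheory GRing.Theory Num.Theory numFieldTopology.Exports.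

Local Open Scope classical_set_scope.
Local Open Scope ring_scope.
Local Open Scope quotient_scope.

Definition mkadditive (U V : zmodType) (f : U -> V) (fB : zmod_morphism f) :
  {additive U -> V} := HB.pack f (GRing.isZmodMorphism.Build U V f fB).

Record chcomplex := ChComplex {
  chobj :> int -> zmodType;
  chd : forall n, {additive chobj n -> chobj (n - 1)};
  chdK : forall n x, chd (n - 1) (chd n x) = 0 }.

Record chmap (C D : chcomplex) := ChMap {
  chmapf :> forall n, {additive C n -> D n};
  chmapd : forall n x, chmapf (n - 1) (chd C n x) = chd D n (chmapf n x) }.

(* [m - 1 = n] does not determine [m] up to conversion, hence the transport. *)
Definition chcast (C : chcomplex) (m n : int) (e : m = n) (x : C m) : C n :=
  ecast k (C k) e x.

Lemma chcast0 (C : chcomplex) (m n : int) (e : m = n) :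
  chcast e (0 : C m) = 0.
Proof. by case: _ / e. Qed.

Lemma chcastB (C : chcomplex) (m n : int) (e : m = n) (x y : C m) :
  chcast e (x - y) = chcast e x - chcast e y.
Proof. by case: _ / e. Qed.

Definition is_boundary (C : chcomplex) (n : int) (x : C n) : Prop :=
  exists (m : int) (e : m - 1 = n) (y : C m), x = chcast e (chd C m y).

Lemma is_boundaryP (C : chcomplex) (n : int) (x : C (n - 1)) :
  is_boundary x <-> exists y : C n, x = chd C n y.
Proof.
split=> [[m [e [y ->]]]|[y ->]]; last by exists n, erefl, y.
have emn : m = n by exact: (addIr _ e).
by case: _ / emn in x e *; exists y; rewrite (eq_irrelevance e erefl).
Qed.

Lemma is_boundary0 (C : chcomplex) (n : int) : is_boundary (0 : C n).
Proof.
have e : n + 1 - 1 = n by exact: addrK.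
by exists (n + 1), e, 0; rewrite raddf0 chcast0.
Qed.

Section Homology.
Variables (C : chcomplex) (n : int).

Definition cycle_pred : {pred C n} := [pred x | chd C n x == 0].

Fact cycle_zmod_closed : zmod_closed cycle_pred.
Proof.
split=> [|x y]; rewrite !inE ?raddf0// => /eqP dx /eqP dy.
by rewrite raddfB /= dx dy subrr.
Qed.
HB.instance Definition _ :=
  GRing.isZmodClosed.Build (C n) cycle_pred cycle_zmod_closed.

Record cycle := Cycle { cycle_val : C n; _ : cycle_val \in cycle_pred }.
HB.instance Definition _ := [isSub for cycle_val].
HB.instance Definition _ := [Choice of cycle by <:].
HB.instance Definition _ := [SubChoice_isSubZmodule of cycle by <:].

Lemma cycle_valB (x y : cycle) :
  cycle_val (x - y) = cycle_val x - cycle_val y.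
Proof. exact: (raddfB (\val : {additive cycle -> C n})). Qed.

Definition boundary_pred : {pred cycle} :=
  [pred z | `[< is_boundary (cycle_val z) >]].

Fact boundary_zmod_closed : zmod_closed boundary_pred.
Proof.
split=> [|x y]; rewrite !inE; first exact: is_boundary0.
move=> [m [e [u hu]]] [m' [e' [v hv]]].
have emm : m = m' by apply: (addIr (-1)); rewrite e e'.
case: _ / emm in e' v hv *; exists m, e, (u - v).
rewrite (eq_irrelevance e' e) in hv.
by rewrite cycle_valB hu hv raddfB chcastB.
Qed.
HB.instance Definition _ :=
  GRing.isZmodClosed.Build cycle boundary_pred boundary_zmod_closed.

Definition homology : Type := Quotient.quot boundary_pred.
HB.instance Definition _ :=
  GRing.Zmodule.copy homology (Quotient.quot boundary_pred).

Fact cycle_mem (x : C n) (dx : chd C n x = 0) : x \in cycle_pred.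
Proof. by rewrite inE dx. Qed.

Definition hclass (x : C n) (dx : chd C n x = 0) : homology :=
  \pi_(Quotient.quot boundary_pred) (Cycle (cycle_mem dx)).

Lemma hclass_surj (u : homology) : exists x dx, u = @hclass x dx.
Proof.
elim/quotW: u => -[x xZ]; have dx : chd C n x = 0 by move: xZ; rewrite inE => /eqP.
by exists x, dx; congr (\pi_(_) _); exact/val_inj.
Qed.

Lemma hclass_eq x y dx dy :
  @hclass x dx = @hclass y dy <-> is_boundary (x - y).
Proof.
rewrite (rwP eqP) /hclass -Quotient.idealrBE inE.
by rewrite cycle_valB.
Qed.

Lemma hclassB x y dx dy dxy :
  @hclass x dx - @hclass y dy = @hclass (x - y) dxy.
Proof.
rewrite /hclass -[LHS](raddfB \pi_(Quotient.quot boundary_pred)).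
by congr (\pi_(_) _); apply/val_inj; exact: cycle_valB.
Qed.

Lemma hclass_eq0 x dx : @hclass x dx = 0 <-> is_boundary x.
Proof.
have d0 : chd C n 0 = 0 by rewrite raddf0.
have d00 : chd C n (0 - 0) = 0 by rewrite subr0.
have -> : (0 : homology) = hclass d0.
  rewrite -(subrr (hclass d0)) (hclassB _ _ d00); apply/hclass_eq.
  by rewrite !subr0; exact: is_boundary0.
by rewrite hclass_eq subr0.
Qed.

End Homology.
Arguments hclass {C n x} dx.

Section InducedMap.
Variables (C D : chcomplex) (n m : int) (g : {additive C n -> D m}).
Hypothesis gZ : forall x, chd C n x = 0 -> chd D m (g x) = 0.
Hypothesis gB : forall x, is_boundary x -> is_boundary (g x).

Fact hmap_ex (u : homology C n) : exists v : homology D m,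
  exists x (dx : chd C n x = 0), u = hclass dx /\ v = hclass (gZ dx).
Proof.
by have [x [dx ->]] := hclass_surj u; exists (hclass (gZ dx)), x, dx.
Qed.

Definition hmap_fun u := sval (cid (hmap_ex u)).

Fact hmap_funE x (dx : chd C n x = 0) : hmap_fun (hclass dx) = hclass (gZ dx).
Proof.
rewrite /hmap_fun; case: cid => /= v [y [dy [/esym/hclass_eq yx ->]]].
by apply/hclass_eq; rewrite -raddfB; exact: gB.
Qed.

Fact hmap_funB : zmod_morphism hmap_fun.
Proof.
move=> u v; have [x [dx ->]] := hclass_surj u.
have [y [dy ->]] := hclass_surj v.
have dxy : chd C n (x - y) = 0 by rewrite raddfB /= dx dy subrr.
rewrite (hclassB _ _ dxy) !hmap_funE.
have dg : chd D m (g x - g y) = 0 by rewrite raddfB /= !gZ ?subrr.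
rewrite (hclassB _ _ dg); apply/hclass_eq; rewrite raddfB subrr.
exact: is_boundary0.
Qed.

Definition hmap : {additive homology C n -> homology D m} :=
  mkadditive hmap_funB.

Lemma hmapE x (dx : chd C n x = 0) : hmap (hclass dx) = hclass (gZ dx).
Proof. exact: hmap_funE. Qed.

End InducedMap.

(* Short exact sequences 0 -> A -> B -> C -> 0 whose second map lowers the
   degree by one.  The first map anticommutes with the differentials, so that
   it still preserves cycles and boundaries. *)
Record ses (A B C : chcomplex) := Ses {
  sesi : forall n, {additive A n -> B n};
  sesp : forall n, {additive B n -> C (n - 1)};
  sesid : forall n x, chd B n (sesi n x) = - sesi (n - 1) (chd A n x);
  sespd : forall n y, chd C (n - 1) (sesp n y) = sesp (n - 1) (chd B n y);
  sesi_inj : forall n, injective (sesi n);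
  ses_exact : forall n y, sesp n y = 0 <-> exists x, sesi n x = y;
  sesp_surj : forall n z, exists y, sesp n y = z }.

Section LongExactSequence.
Variables (A B C : chcomplex) (S : ses A B C).

Fact sesiZ n x : chd A n x = 0 -> chd B n (sesi S n x) = 0.
Proof. by rewrite sesid => ->; rewrite raddf0 oppr0. Qed.

Fact sesiB n (x : A n) : is_boundary x -> is_boundary (sesi S n x).
Proof.
move=> [m [e [y ->]]]; exists m, e, (- sesi S m y).
by rewrite raddfN /= sesid opprK; case: _ / e.
Qed.

Definition hsesi (n : int) : {additive homology A n -> homology B n} :=
  hmap (@sesiZ n) (@sesiB n).

Fact sespZ n y : chd B n y = 0 -> chd C (n - 1) (sesp S n y) = 0.
Proof. by rewrite sespd => ->; rewrite raddf0. Qed.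

Fact sespB n (y : B n) : is_boundary y -> is_boundary (sesp S n y).
Proof.
move=> [m [e [z ->]]]; case: _ / e => /=.
by exists (m - 1), erefl, (sesp S m z); rewrite sespd.
Qed.

Definition hsesp (n k : int) (e : n - 1 = k) :
    {additive homology B n -> homology C k} :=
  match e in _ = k' return {additive homology B n -> homology C k'} with
  | erefl => hmap (@sespZ n) (@sespB n)
  end.

Section Connecting.
Variable n : int.

(* The class of [sesp y] is sent to the class of [w] when [sesi w] is the
   differential of [y]. *)
Definition conn_spec (u : homology C (n - 1)) (v : homology A (n - 1)) :=
  exists (y : B n) (w : A (n - 1))
    (dy : chd C (n - 1) (sesp S n y) = 0) (dw : chd A (n - 1) w = 0),
    [/\ sesi S (n - 1) w = chd B n y, u = hclass dy & v = hclass dw].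

Fact conn_ex u : exists v, conn_spec u v.
Proof.
have [z [dz ->]] := hclass_surj u.
have [y yz] := sesp_surj S z; case: _ / yz in dz *.
have [w wy] : exists w, sesi S (n - 1) w = chd B n y.
  by apply/ses_exact; rewrite -sespd.
have dw : chd A (n - 1) w = 0.
  by apply: (@sesi_inj _ _ _ S); apply: oppr_inj; rewrite -sesid wy chdK raddf0 oppr0.
by exists (hclass dw), y, w, dz, dw.
Qed.

Fact conn_core (y : B n) (w : A (n - 1)) :
  sesi S (n - 1) w = chd B n y -> is_boundary (sesp S n y) -> is_boundary w.
Proof.
move=> wy [m [e [c yc]]].
have emn : m = n by exact: (addIr _ e).
case: _ / emn in y w wy e c yc *.
rewrite (eq_irrelevance e erefl) /= in yc.
have e1 : m + 1 - 1 = m by exact: addrK.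
have [b [bc bB]] : exists b : B m, sesp S m b = chd C m c /\ chd B m b = 0.
  clear wy e yc y w; case: _ / e1 in c *.
  have [b bc] := sesp_surj S c; exists (chd B _ b).
  by rewrite -sespd bc chdK.
have [a aE] : exists a, sesi S m a = y - b.
  by apply/ses_exact; rewrite raddfB /= yc bc subrr.
apply/is_boundaryP; exists (- a); apply: (@sesi_inj _ _ _ S).
by rewrite wy !raddfN /= -sesid aE raddfB /= bB subr0.
Qed.

Fact conn_uniq u v u' v' u'' v'' : conn_spec u v -> conn_spec u' v' ->
  conn_spec u'' v'' -> u'' = u - u' -> v'' = v - v'.
Proof.
move=> [y [w [dy [dw [wy -> ->]]]]] [y' [w' [dy' [dw' [wy' -> ->]]]]].
move=> [y'' [w'' [dy'' [dw'' [wy'' -> ->]]]]].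
have dyy : chd C (n - 1) (sesp S n y - sesp S n y') = 0.
  by rewrite raddfB /= dy dy' subrr.
have dww : chd A (n - 1) (w - w') = 0 by rewrite raddfB /= dw dw' subrr.
rewrite (hclassB _ _ dyy) (hclassB _ _ dww) => /hclass_eq uB; apply/hclass_eq.
apply: (@conn_core (y'' - (y - y'))).
  by rewrite !(raddfB (sesi S _)) !(raddfB (chd B n)) wy wy' wy''.
by rewrite !(raddfB (sesp S n)).
Qed.

Definition conn_fun u : homology A (n - 1) := sval (cid (conn_ex u)).

Fact conn_funB : zmod_morphism conn_fun.
Proof.
move=> u u'; rewrite /conn_fun; case: cid => /= v''; case: cid => /= v.
by case: cid => /= v' s' s s''; exact: conn_uniq s s' s'' _.
Qed.

Definition connecting0 : {additive homology C (n - 1) -> homology A (n - 1)} :=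
  mkadditive conn_funB.

Lemma connecting0E (y : B n) (w : A (n - 1))
    (dy : chd C (n - 1) (sesp S n y) = 0) (dw : chd A (n - 1) w = 0) :
  sesi S (n - 1) w = chd B n y -> connecting0 (hclass dy) = hclass dw.
Proof.
move=> wy; rewrite /= /conn_fun; case: cid => /= v s.
have s0 : conn_spec 0 0.
  have d0 : chd C (n - 1) (sesp S n 0) = 0 by rewrite !raddf0.
  have d0' : chd A (n - 1) 0 = 0 by rewrite raddf0.
  exists 0, 0, d0, d0'; rewrite !raddf0; split=> //; apply/esym/hclass_eq0.
    by rewrite raddf0; exact: is_boundary0.
  exact: is_boundary0.
have s' : conn_spec (hclass dy) (hclass dw) by exists y, w, dy, dw.
by rewrite (conn_uniq s' s0 s) subr0.
Qed.

End Connecting.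

Definition connecting (n k : int) (e : n - 1 = k) :
    {additive homology C k -> homology A k} :=
  match e in _ = k' return {additive homology C k' -> homology A k'} with
  | erefl => connecting0 n
  end.

End LongExactSequence.

Section Cone.
Variables (L M : chcomplex) (h : chmap L M).

Definition cone_d (n : int) (x : (L (n - 1) * M n)%type) :
    (L (n - 1 - 1) * M (n - 1))%type :=
  (chd L (n - 1) x.1, - chd M n x.2 + h (n - 1) x.1).

Fact cone_dB n : zmod_morphism (@cone_d n).
Proof.
move=> x y; congr pair; first exact: raddfB.
by rewrite /= (raddfB (chd M n)) (raddfB (h _)) !opprD addrACA.
Qed.

Fact cone_dK n x : mkadditive (@cone_dB (n - 1)) (mkadditive (@cone_dB n) x) = 0.
Proof.
congr pair; rewrite /= ?chdK//.
by rewrite raddfD raddfN /= chdK oppr0 add0r chmapd addNr.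
Qed.

Definition cone : chcomplex :=
  @ChComplex (fun n => (L (n - 1) * M n)%type : zmodType)
    (fun n => mkadditive (@cone_dB n)) cone_dK.

End Cone.

Section ConeMap.
Variables (L M L' M' : chcomplex) (h : chmap L M) (h' : chmap L' M').
Variables (a : chmap L L') (b : chmap M M').
Hypothesis ab : forall n x, h' n (a n x) = b n (h n x).

Definition cone_map_fun (n : int) (x : cone h n) : cone h' n :=
  (a (n - 1) x.1, b n x.2).

Fact cone_map_funB n : zmod_morphism (@cone_map_fun n).
Proof. by move=> x y; congr pair; exact: raddfB. Qed.

Fact cone_map_fund n x : mkadditive (@cone_map_funB (n - 1)) (chd (cone h) n x) =
  chd (cone h') n (mkadditive (@cone_map_funB n) x).
Proof.
congr pair; rewrite /= ?chmapd//.
by rewrite raddfD raddfN /= chmapd ab.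
Qed.

Definition cone_map : chmap (cone h) (cone h') := ChMap cone_map_fund.

End ConeMap.

Definition seqprod (V : nat -> zmodType) : Type := forall i, V i.

Section SeqProd.
Variable V : nat -> zmodType.

HB.instance Definition _ := gen_eqMixin (seqprod V).
HB.instance Definition _ := gen_choiceMixin (seqprod V).

Definition seqprod_add (c d : seqprod V) : seqprod V := fun i => c i + d i.
Definition seqprod_opp (c : seqprod V) : seqprod V := fun i => - c i.
Definition seqprod_zero : seqprod V := fun=> 0.

Fact seqprod_addA : associative seqprod_add.
Proof. by move=> c d e; apply/functional_extensionality_dep => i; exact: addrA. Qed.
Fact seqprod_addC : commutative seqprod_add.
Proof. by move=> c d; apply/functional_extensionality_dep => i; exact: addrC. Qed.
Fact seqprod_add0 : left_id seqprod_zero seqprod_add.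
Proof. by move=> c; apply/functional_extensionality_dep => i; exact: add0r. Qed.
Fact seqprod_addN : left_inverse seqprod_zero seqprod_opp seqprod_add.
Proof. by move=> c; apply/functional_extensionality_dep => i; exact: addNr. Qed.

HB.instance Definition _ := GRing.isZmodule.Build (seqprod V)
  seqprod_addA seqprod_addC seqprod_add0 seqprod_addN.

End SeqProd.

Section ProductComplex.
Variable C : nat -> chcomplex.

Definition prod_d (n : int) (c : seqprod (C ^~ n)) : seqprod (C ^~ (n - 1)) :=
  fun i => chd (C i) n (c i).

Fact prod_dB n : zmod_morphism (@prod_d n).
Proof.
by move=> c d; apply/functional_extensionality_dep => i; exact: raddfB.
Qed.

Fact prod_dK n c : mkadditive (@prod_dB (n - 1)) (mkadditive (@prod_dB n) c) = 0.
Proof. by apply/functional_extensionality_dep => i; exact: chdK. Qed.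

Definition prod_complex : chcomplex :=
  @ChComplex (fun n => seqprod (C ^~ n) : zmodType)
    (fun n => mkadditive (@prod_dB n)) prod_dK.

Variable q : forall i, chmap (C i.+1) (C i).

Definition bonding_fun (n : int) (c : prod_complex n) : prod_complex n :=
  fun i => q i n (c i.+1) - c i.

Fact bonding_funB n : zmod_morphism (@bonding_fun n).
Proof.
move=> c d; apply/functional_extensionality_dep => i.
by rewrite /bonding_fun (raddfB (q i n)) !opprD addrACA.
Qed.

Fact bonding_fund n c :
  mkadditive (@bonding_funB (n - 1)) (chd prod_complex n c) =
  chd prod_complex n (mkadditive (@bonding_funB n) c).
Proof.
apply/functional_extensionality_dep => i.
by rewrite /= /bonding_fun /prod_d raddfB /= chmapd.
Qed.

Definition bonding_map : chmap prod_complex prod_complex := ChMap bonding_fund.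

End ProductComplex.

Section MapTower.
Variables (L M : nat -> chcomplex) (h : forall i, chmap (L i) (M i)).
Variables (q : forall i, chmap (L i.+1) (L i)) (q' : forall i, chmap (M i.+1) (M i)).
Hypothesis hq : forall i n x, h i n (q i n x) = q' i n (h i.+1 n x).

Definition tower_bonding (i : nat) : chmap (cone (h i.+1)) (cone (h i)) :=
  cone_map (@hq i).

(* C(p_#), C(p'_#) and C(p_#, p'_#). *)
Definition dom_cone : chcomplex := cone (bonding_map q).
Definition cod_cone : chcomplex := cone (bonding_map q').
Definition map_cone : chcomplex := cone (bonding_map tower_bonding).

(* With the differential (l, m) |-> (d l, - d m + h l) for both the inner and
   the outer cones, the map (c, c') |-> ({(0, c_i)}, {(0, c'_i)}) neither
   commutes nor anticommutes with the differentials, and does not preserve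
   cycles.  With the sign in the second component it anticommutes with them,
   and the connecting homomorphism is induced by h. *)
Definition sigma_fun (n : int) (x : cod_cone n) : map_cone n :=
  (fun i => (0, x.1 i), fun i => (0, - x.2 i)).

Definition del_fun (n : int) (y : map_cone n) : dom_cone (n - 1) :=
  (fun i => (y.1 i).1, fun i => (y.2 i).1).

Fact sigma_funB n : zmod_morphism (@sigma_fun n).
Proof.
move=> x y; congr pair; apply/functional_extensionality_dep => i; congr pair.
- by rewrite subr0.
- by rewrite subr0.
- exact: opprD.
Qed.

Fact del_funB n : zmod_morphism (@del_fun n).
Proof. by []. Qed.

Definition sigma n := mkadditive (@sigma_funB n).
Definition del n := mkadditive (@del_funB n).

Fact sigmad n x : chd map_cone n (sigma n x) = - sigma (n - 1) (chd cod_cone n x).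
Proof.
congr pair; apply/functional_extensionality_dep => i; congr pair => /=.
- by rewrite /= raddf0 oppr0.
- by rewrite /= raddf0 addr0.
- rewrite /= /bonding_fun /= raddf0 oppr0 add0r.
  by rewrite (raddf0 (q i _)) addr0.
- rewrite /= (raddf0 (h i (n - 1))) (raddfN (chd (M i) n)) addr0 opprK.
  by rewrite !opprD !opprK.
Qed.

Fact deld n y : chd dom_cone (n - 1) (del n y) = del (n - 1) (chd map_cone n y).
Proof. by []. Qed.

Fact sigma_inj n : injective (sigma n).
Proof.
move=> [a b] [c d] [ac bd]; congr pair; apply/functional_extensionality_dep => i.
  by have := congr1 (@^~ i) ac => -[].
by have := congr1 (@^~ i) bd => -[] /oppr_inj.
Qed.

Fact sigma_del n y : del n y = 0 <-> exists x, sigma n x = y.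
Proof.
split=> [|[x <-]//]; case: y => a b [a0 b0].
exists (fun i => (a i).2, fun i => - (b i).2); congr pair => /=.
  apply/functional_extensionality_dep => i; have := congr1 (@^~ i) a0 => /= {a0}.
  by case: (a i) => ? ? /= ->.
apply/functional_extensionality_dep => i; have := congr1 (@^~ i) b0 => /= {b0}.
by rewrite opprK; case: (b i) => ? ? /= ->.
Qed.

Fact del_surj n z : exists y, del n y = z.
Proof.
by case: z => a b; exists (fun i => (a i, 0), fun i => (b i, 0)).
Qed.

(* 0 -> C(p'_#) -> C(p_#, p'_#) -> C(p_#) -> 0 *)
Definition cone_ses : ses cod_cone map_cone dom_cone :=
  Ses sigmad deld sigma_inj sigma_del del_surj.

End MapTower.

Definition fgadditive (K : choiceType) (M : lmodType int) (f : K -> M) :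
  {additive {freeg K} -> M} := mkadditive (lift_is_additive f).

Lemma fgliftU (K : choiceType) (M : lmodType int) (f : K -> M) (k : K) :
  fglift f << k >> = f k.
Proof. by rewrite liftU scale1r. Qed.

Lemma freeg_additive_ext (K : choiceType) (M : zmodType)
    (f g : {additive {freeg K} -> M}) :
  (forall k, f << k >> = g << k >>) -> f =1 g.
Proof.
move=> fg D; rewrite -[D]freeg_sumE !raddf_sum; apply: eq_bigr => k _.
by rewrite -[coeff _ _]intz -freegU_mulz !raddfMz fg.
Qed.

Definition std_simplex (R : realType) (n : nat) : set 'rV[R]_n.+1 :=
  [set t | (forall i, 0 <= t 0 i) /\ \sum_i t 0 i = 1].
Arguments std_simplex : clear implicits.

Section StandardSimplex.
Variable R : realType.

(* The i-th face inserts a zero i-th barycentric coordinate. *)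
Definition face_row (n : nat) (i : 'I_n.+2) (t : 'rV[R]_n.+1) : 'rV[R]_n.+2 :=
  \row_j oapp (t 0) 0 (unlift i j).

Fact face_row_mem n i (t : 'rV[R]_n.+1) :
  std_simplex R n t -> std_simplex R n.+1 (face_row i t).
Proof.
move=> [t0 t1]; split=> [j|].
  by rewrite mxE; case: unliftP => [k|] _ //=.
rewrite -[RHS]t1 (bigD1_ord i)//= mxE unlift_none add0r.
by apply: eq_bigr => j _; rewrite mxE liftK.
Qed.

Definition face_fun (n : nat) (i : 'I_n.+2) (t : std_simplex R n) :
    std_simplex R n.+1 :=
  SigSub (mem_set (face_row_mem i (set_valP t))).

Fact face_row_continuous n i : continuous (@face_row n i).
Proof.
move=> t A [P tP sPA]; exists (fun k l => P k (fintype.lift i l)).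
  by move=> k l; have := tP k (fintype.lift i l); rewrite mxE liftK (ord1 k).
move=> N NP; apply: sPA => k l; rewrite mxE.
case: unliftP => [m ->|il] /=; first by have := NP k m; rewrite (ord1 k).
have := nbhs_singleton (tP k l).
by rewrite mxE il unlift_none.
Qed.

Fact face_fun_continuous n i : continuous (@face_fun n i).
Proof.
apply: (@continuous_comp_initial _ _ _ set_val (@face_fun n i)).
rewrite (_ : _ \o _ = face_row i \o set_val)//.
move=> t; apply: continuous_comp; last exact: face_row_continuous.
exact: initial_continuous.
Qed.

HB.instance Definition _ n i :=
  @isContinuous.Build _ _ (@face_fun n i) (@face_fun_continuous n i).

Lemma face_face n (i : 'I_n.+2) (j : 'I_n.+3) (i' : 'I_n.+3) (j' : 'I_n.+2) t :
  (i < j)%N -> i = i' :> nat -> j = j'.+1 :> nat ->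
  face_fun j (face_fun i t) = face_fun i' (face_fun j' t).
Proof.
move=> ij ii' jj'; apply/val_inj/rowP => k; rewrite /= !mxE.
have liftE m : fintype.lift j (fintype.lift i m) = fintype.lift i' (fintype.lift j' m).
  by apply/ord_inj; rewrite /= /bump; lia.
have liftij : fintype.lift j i = i' by apply/ord_inj; rewrite /= /bump; lia.
have liftij' : j = fintype.lift i' j' by apply/ord_inj; rewrite /= /bump; lia.
case: (unliftP j k) => [l|] ->; last first.
  by rewrite liftij' liftK /= mxE unlift_none.
rewrite [oapp _ _ (Some l)]/= mxE; case: (unliftP i l) => [m|] ->.
  by rewrite /= liftE liftK /= mxE liftK.
by rewrite /= liftij unlift_none.
Qed.

End StandardSimplex.

Section SingularComplex.
Variables (R : realType) (X : topologicalType).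

(* Singular simplices; there are none in negative dimensions. *)
Definition sing_simplex (n : int) : choiceType :=
  match n with
  | Posz k => continuousType (std_simplex R k) X
  | Negz _ => void
  end.

Definition sing_chain (n : int) : lmodType int := {freeg (sing_simplex n)}.

Definition face (k : nat) (i : 'I_k.+2) (s : sing_simplex k.+1) : sing_simplex k :=
  [the continuousType _ _ of (s : continuousType _ _) \o face_fun i].

Fact subSz1 (k : nat) : k%:Z = k.+1%:Z - 1.
Proof. by rewrite -addn1 PoszD addrK. Qed.

Definition face_sum (k : nat) (s : sing_simplex k.+1) : sing_chain k :=
  \sum_(i < k.+2) (-1) ^+ i *: << face i s >>.

(* [k.+1%:Z - 1] is not convertible to [k], hence the transport. *)
Definition sing_bd (n : int) : sing_simplex n -> sing_chain (n - 1) :=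
  match n return sing_simplex n -> sing_chain (n - 1) with
  | Posz k.+1 => fun s => ecast m (sing_chain m) (subSz1 k) (face_sum s)
  | _ => fun=> 0
  end.

Definition sing_d (n : int) : {additive sing_chain n -> sing_chain (n - 1)} :=
  fgadditive (@sing_bd n).

Fact ecast_additive_subproof (U : zmodType) (m n : int) (e : m = n)
    (g : {additive U -> sing_chain m}) :
  zmod_morphism (fun x => ecast k (sing_chain k) e (g x)).
Proof. by case: _ / e => x y; exact: raddfB. Qed.

Fact sing_d_cast (m n : int) (e : m = n) (x : sing_chain m) :
  sing_d m x = 0 -> sing_d n (ecast k (sing_chain k) e x) = 0.
Proof. by case: _ / e. Qed.

Lemma face_faceE (k : nat) (i : 'I_k.+2) (j : 'I_k.+3) (i' : 'I_k.+3)
    (j' : 'I_k.+2) (s : sing_simplex k.+2) :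
  (i < j)%N -> i = i' :> nat -> j = j'.+1 :> nat ->
  face i (face j s) = face j' (face i' s).
Proof.
move=> ij ii' jj'; apply/continuousEP => t /=.
by congr (s _); exact: face_face.
Qed.

Fact face_face_sum (k : nat) (s : sing_simplex k.+2) :
  fglift (@face_sum k) (face_sum s) = 0.
Proof.
rewrite -[LHS]/(fgadditive (@face_sum k) _) raddf_sum.
pose G (p : 'I_k.+3 * 'I_k.+2) : sing_chain k :=
  (-1) ^+ (p.1 + p.2) *: << face p.2 (face p.1 s) >>.
transitivity (\sum_p G p).
  rewrite -(pair_bigA _ (fun i j => G (i, j))); apply: eq_bigr => i _.
  rewrite raddfZsign /= fgliftU scaler_sumr; apply: eq_bigr => j _.
  by rewrite scalerA -exprD.
rewrite (bigID (fun p : 'I_k.+3 * 'I_k.+2 => (p.2 < p.1)%N)) /=.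
pose u (p : 'I_k.+3 * 'I_k.+2) : 'I_k.+3 * 'I_k.+2 :=
  (inord p.2, inord p.1.-1).
pose v (p : 'I_k.+3 * 'I_k.+2) : 'I_k.+3 * 'I_k.+2 :=
  (inord p.2.+1, inord p.1).
have uv (p : 'I_k.+3 * 'I_k.+2) : ~~ (p.2 < p.1)%N -> u (v p) = p.
  case: p => a b /= ab; congr pair; apply/ord_inj; have := ltn_ord b.
    by move=> bk; rewrite /= !inordK; lia.
  by move=> bk; rewrite /= !inordK; lia.
rewrite [X in _ + X](reindex_onto u v uv) /=.
rewrite [X in _ + X](eq_bigl (fun p : 'I_k.+3 * 'I_k.+2 => (p.2 < p.1)%N)); last first.
  move=> [a b] /=; have := ltn_ord a; have := ltn_ord b => bk ak.
  rewrite !inordK; [|lia|lia].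
  apply/andP/idP => [[ab /eqP[/(congr1 val) /= + _]]|ab].
    by rewrite !inordK; lia.
  split; first lia.
  by apply/eqP; congr pair; apply/ord_inj; rewrite /= !inordK; lia.
rewrite -big_split big1//= => -[a b] /= ab.
have := ltn_ord a; have := ltn_ord b => bk ak.
rewrite /G /= (@face_faceE k b a (inord b) (inord a.-1))//; last first.
- by rewrite inordK; lia.
- by rewrite inordK; lia.
rewrite -scalerDl !inordK; [|lia|lia].
rewrite (_ : (a + b = (b + a.-1).+1)%N); last by lia.
by rewrite exprS mulN1r addNr scale0r.
Qed.

Fact sing_dK n x : sing_d (n - 1) (sing_d n x) = 0.
Proof.
suff H s : sing_d (n - 1) (sing_bd s) = 0.
  have := @freeg_additive_ext _ _ (sing_d (n - 1) \o sing_d n) \0.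
  by move=> /(_ _ x); apply=> s; rewrite /= fgliftU; exact: H.
clear x; case: n s => [[|k]|k] s; [exact: raddf0| |exact: raddf0].
apply: (sing_d_cast (subSz1 k)); case: k s => [|k] s.
  by rewrite raddf_sum big1// => i _; rewrite raddfZsign /= fgliftU scaler0.
have -> : sing_d k.+1 (face_sum s) =
    ecast m (sing_chain m) (subSz1 k) (fglift (@face_sum k) (face_sum s)).
  move: (face_sum s); apply: (@freeg_additive_ext _ _ (sing_d k.+1) 
    (mkadditive (@ecast_additive_subproof _ _ _ (subSz1 k)
      (fgadditive (@face_sum k))))).
  by move=> s'; rewrite /= !fgliftU.
by rewrite face_face_sum; case: _ / (subSz1 k).
Qed.

Definition singular : chcomplex := @ChComplex sing_chain sing_d sing_dK.

End SingularComplex.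

Section SingularMap.
Variables (R : realType) (X Y : topologicalType) (f : continuousType X Y).

Definition push_simplex (n : int) : sing_simplex R X n -> sing_simplex R Y n :=
  match n with
  | Posz k => fun s : continuousType (std_simplex R k) X =>
      [the continuousType _ _ of f \o s]
  | Negz _ => id
  end.

Definition sing_map_fun (n : int) :
    {additive singular R X n -> singular R Y n} :=
  fgadditive (fun s => << push_simplex s >> : sing_chain R Y n).

Fact sing_map_cast (m n : int) (e : m = n) (x : sing_chain R X m) :
  ecast k (sing_chain R Y k) e (sing_map_fun m x) =
  sing_map_fun n (ecast k (sing_chain R X k) e x).
Proof. by case: _ / e. Qed.

Fact sing_map_d n x :
  sing_map_fun (n - 1) (chd (singular R X) n x) =
  chd (singular R Y) n (sing_map_fun n x).
Proof.
move: x; apply: (@freeg_additive_ext _ _ (sing_map_fun (n - 1) \o sing_d R X n)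
  (sing_d R Y n \o sing_map_fun n)).
move=> s; rewrite /= !fgliftU; case: n s => [[|k]|k] s.
- exact: (raddf0 (sing_map_fun _)).
- apply: etrans (esym (sing_map_cast (subSz1 k) _)) _; congr (ecast _ _ _ _).
  rewrite /face_sum -[LHS]/(sing_map_fun k _) raddf_sum; apply: eq_bigr => i _.
  rewrite raddfZsign /= fgliftU; congr (_ *: << _ >>).
  exact/continuousEP.
- exact: (raddf0 (sing_map_fun _)).
Qed.

Definition sing_map : chmap (singular R X) (singular R Y) := ChMap sing_map_d.

End SingularMap.

Lemma sing_map_comp (R : realType) (X Y Z W : topologicalType)
    (f : continuousType X Y) (g : continuousType Y W)
    (f' : continuousType X Z) (g' : continuousType Z W) :
  (forall x, g (f x) = g' (f' x)) -> forall n x,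
  sing_map R g n (sing_map R f n x) = sing_map R g' n (sing_map R f' n x).
Proof.
move=> gf n; apply: (@freeg_additive_ext _ _ (sing_map R g n \o sing_map R f n)
  (sing_map R g' n \o sing_map R f' n)).
move=> s; rewrite /= !fgliftU; congr << _ >>; case: n s => //= k s.
by apply/continuousEP => t /=; exact: gf.
Qed.

Definition closed_embedding (Y Z : topologicalType) (e : Y -> Z) : Prop :=
  [/\ continuous e, injective e & forall A, closed A -> closed (e @` A)].

(* Absolute neighbourhood retracts for metric spaces.  The retraction is a
   function on the subtype of points of [U], so that [Y] may be empty. *)
Definition is_ANR (R : realType) (Y : metricType R) : Prop :=
  forall (Z : metricType R) (e : Y -> Z), closed_embedding e ->
  exists (U : set Z) (r : U -> Y),
    [/\ open U, range e `<=` U, continuous r &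
        forall (y : Y) (z : U), set_val z = e y -> r z = y].

Definition is_morphism (X X' Y Y' : topologicalType) (f : X -> X') (g : Y -> Y')
    (phi : X -> Y) (phi' : X' -> Y') : Prop :=
  [/\ continuous phi, continuous phi' & forall x, g (phi x) = phi' (f x)].

Definition unit_interval (R : realType) : set R := [set t | 0 <= t <= 1].
Arguments unit_interval : clear implicits.

Section Homotopy.
Variable R : realType.

Definition I0 : unit_interval R :=
  SigSub (mem_set (introT andP (conj (lexx 0) ler01) : unit_interval R 0)).
Definition I1 : unit_interval R :=
  SigSub (mem_set (introT andP (conj ler01 (lexx 1)) : unit_interval R 1)).

(* f x 1_I *)
Definition cylinder (X X' : topologicalType) (f : X -> X')
    (xt : X * unit_interval R) : X' * unit_interval R := (f xt.1, xt.2).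

Definition is_homotopy (X X' Y Y' : topologicalType) (f : X -> X') (g : Y -> Y')
    (phi0 : X -> Y) (phi0' : X' -> Y') (phi1 : X -> Y) (phi1' : X' -> Y')
    (F : X * unit_interval R -> Y) (F' : X' * unit_interval R -> Y') : Prop :=
  [/\ is_morphism (cylinder f) g F F',
      forall x, F (x, I0) = phi0 x, forall x', F' (x', I0) = phi0' x',
      forall x, F (x, I1) = phi1 x & forall x', F' (x', I1) = phi1' x'].

Definition homotopic (X X' Y Y' : topologicalType) (f : X -> X') (g : Y -> Y')
    (phi0 : X -> Y) (phi0' : X' -> Y') (phi1 : X -> Y) (phi1' : X' -> Y') : Prop :=
  exists F F', is_homotopy f g phi0 phi0' phi1 phi1' F F'.

(* Homotopy of morphisms f x 1_I -> g relative to f x 1_{0,1}. *)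
Definition homotopic_rel_ends (X X' Y Y' : topologicalType) (f : X -> X')
    (g : Y -> Y') (F : X * unit_interval R -> Y) (F' : X' * unit_interval R -> Y')
    (G : X * unit_interval R -> Y) (G' : X' * unit_interval R -> Y') : Prop :=
  exists H H', is_homotopy (cylinder f) g F F' G G' H H' /\
    forall s, s = I0 \/ s = I1 ->
      (forall x t, H ((x, s), t) = F (x, s)) /\
      (forall x' t, H' ((x', s), t) = F' (x', s)).

End Homotopy.

Record inv_seq (R : realType) := InvSeq {
  sdom : nat -> metricType R;
  scod : nat -> metricType R;
  smap : forall i, continuousType (sdom i) (scod i);
  sbd : forall i, continuousType (sdom i.+1) (sdom i);
  sbd' : forall i, continuousType (scod i.+1) (scod i);
  smap_bd : forall i x, smap i (sbd i x) = sbd' i (smap i.+1 x) }.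

(* [bond p k i] is the composite p_(i, k + i) : X_(k + i) -> X_i. *)
Fixpoint bond (X : nat -> Type) (p : forall i, X i.+1 -> X i) (k i : nat) :
    X (k + i)%N -> X i :=
  match k return X (k + i)%N -> X i with
  | 0%N => id
  | k'.+1 => fun x => bond p (p (k' + i)%N x)
  end.
Arguments bond {X} p k i x.

Section StrongExpansion.
Variable R : realType.

Definition is_ANR_seq (T : inv_seq R) : Prop :=
  forall i, [/\ compact [set: sdom T i], is_ANR (sdom T i),
                compact [set: scod T i] & is_ANR (scod T i)].

Variables (X X' : metricType R) (f : X -> X') (T : inv_seq R).
Variables (p : forall i, X -> sdom T i) (p' : forall i, X' -> scod T i).

Definition SE1 : Prop :=
  forall (Y Y' : metricType R) (q : Y -> Y'),
  is_ANR Y -> is_ANR Y' -> continuous q ->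
  forall phi phi', is_morphism f q phi phi' ->
  exists i h h', is_morphism (smap T i) q h h' /\
    homotopic R f q phi phi' (h \o p i) (h' \o p' i).

Definition SE2 : Prop :=
  forall (Y Y' : metricType R) (q : Y -> Y'),
  is_ANR Y -> is_ANR Y' -> continuous q ->
  forall i h0 h0' h1 h1',
  is_morphism (smap T i) q h0 h0' -> is_morphism (smap T i) q h1 h1' ->
  forall (F : X * unit_interval R -> Y) (F' : X' * unit_interval R -> Y'),
  is_homotopy f q (h0 \o p i) (h0' \o p' i)
    (h1 \o p i) (h1' \o p' i) F F' ->
  exists k G G', is_homotopy (smap T (k + i)%N) q
      (h0 \o bond (sbd T) k i) (h0' \o bond (sbd' T) k i)
      (h1 \o bond (sbd T) k i) (h1' \o bond (sbd' T) k i) G G' /\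
    homotopic_rel_ends f q
      (G \o cylinder (p (k + i)%N)) (G' \o cylinder (p' (k + i)%N)) F F'.

Definition is_strong_ANR_expansion : Prop :=
  [/\ is_ANR_seq T,
      forall i, is_morphism f (smap T i) (p i) (p' i),
      forall i x, sbd T i (p i.+1 x) = p i x,
      forall i x', sbd' T i (p' i.+1 x') = p' i x' &
      SE1 /\ SE2].

End StrongExpansion.

Section StrongHomology.
Variables (R : realType) (T : inv_seq R).

Let h i := sing_map R (smap T i).
Let q i := sing_map R (sbd T i).
Let q' i := sing_map R (sbd' T i).

Fact sing_square i n x : h i n (q i n x) = q' i n (h i.+1 n x).
Proof. by apply: sing_map_comp; exact: smap_bd. Qed.

Definition strong_ses := cone_ses sing_square.

Definition sH_dom (n : int) : zmodType := homology (dom_cone q) (n + 1).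
Definition sH_cod (n : int) : zmodType := homology (cod_cone q') (n + 1).
Definition sH_map (n : int) : zmodType := homology (map_cone sing_square) (n + 1).

Fact sH_shift (n : int) : n + 1 - 1 = n - 1 + 1.
Proof. by rewrite addrAC. Qed.

Definition sigma_star (n : int) : {additive sH_cod n -> sH_map n} :=
  hsesi strong_ses (n + 1).

Definition del_star (n : int) : {additive sH_map n -> sH_dom (n - 1)} :=
  hsesp strong_ses (sH_shift n).

Definition E_star (n : int) : {additive sH_dom n -> sH_cod n} :=
  connecting strong_ses (addrK 1 (n + 1)).

End StrongHomology.

Definition exact_at (U V W : zmodType) (g : U -> V) (h : V -> W) : Prop :=
  forall v, h v = 0 <-> exists u, g u = v.

(* Main.v *)
(* The cones of the bonding maps of X', f and X form a short exact sequence of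
   chain complexes, and the strong homology sequence is its long exact homology
   sequence, shifted by one. *)

Require Import Defs.
From mathcomp Require Import all_boot all_order all_algebra.
From mathcomp Require Import boolp classical_sets functions reals topology.

Import GRing.Theory.

Local Open Scope classical_set_scope.
Local Open Scope ring_scope.

(** The three groups are homologies of the terms of [strong_ses], so the zigzag chase for an
    arbitrary [ses] suffices: exactness at the middle, quotient and sub terms is
    [exact_at_hsesi_hsesp], [exact_at_hsesp_connecting] and [exact_at_connecting_hsesi]. The sign in
    [sesid] leaves kernels and images alone, but decides the signs of the correcting chains. *)

Lemma sesi_cycle (A B C : chcomplex) (S : ses A B C) (n : int) (a : A n) :
  chd B n (sesi S n a) = 0 -> chd A n a = 0.
Proof.
rewrite sesid => /eqP; rewrite oppr_eq0 => /eqP da.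
by apply: (@sesi_inj _ _ _ S); rewrite da raddf0.
Qed.

Lemma exact_at_hsesi_hsesp (A B C : chcomplex) (S : ses A B C) (n k : int)
    (e : n - 1 = k) : exact_at (hsesi S n) (hsesp S e).
Proof.
case: _ / e => v; split=> [|[u <-]]; last first.
  have [x [dx ->]] := hclass_surj u; rewrite !hmapE.
  apply/hclass_eq0; have -> : sesp S n (sesi S n x) = 0.
    by apply/ses_exact; exists x.
  exact: is_boundary0.
have [y [dy ->]] := hclass_surj v; rewrite hmapE => /hclass_eq0 pyB.
have [z pyz] : exists z : C n, sesp S n y = chd C n z by exact/is_boundaryP.
(* With [n] in the form [m - 1], [z] lies in the target of [sesp S m] and can be lifted. *)
have [m em] : exists m : int, m - 1 = n by exists (n + 1); exact: addrK.
case: _ / em in y dy v z pyB pyz *.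
have [b bz] := sesp_surj S z.
(* Subtracting the boundary of the lift [b] keeps the class of [y] and puts it in the kernel of
   [sesp]. *)
have [a ay] : exists a, sesi S (m - 1) a = y - chd B m b.
  by apply/ses_exact; rewrite raddfB /= -sespd bz pyz subrr.
have da : chd A (m - 1) a = 0.
  by apply: (@sesi_cycle _ _ _ S); rewrite ay raddfB /= dy chdK subrr.
exists (hclass da); rewrite hmapE; apply/hclass_eq/is_boundaryP.
by exists (- b); rewrite ay addrAC subrr add0r raddfN.
Qed.

(** Separate [n] and [m] are needed because [del_star] and [E_star] reach the same degree through
    equal but not convertible indices. *)
Lemma exact_at_hsesp_connecting (A B C : chcomplex) (S : ses A B C)
    (n m k : int) (e : n - 1 = k) (e' : m - 1 = k) :
  exact_at (hsesp S e) (connecting S e').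
Proof.
have enm : n = m by apply: (addIr (-1)); rewrite e e'.
case: _ / enm in e' *; rewrite (eq_irrelevance e' e); clear e'.
case: _ / e => v; split=> [|[u <-]]; last first.
  have [y [dy ->]] := hclass_surj u; rewrite hmapE.
  (* The lift [y] is already a cycle, so 0 serves as the preimage of its differential. *)
  have d0 : chd A (n - 1) 0 = 0 by rewrite raddf0.
  rewrite [LHS](connecting0E _ d0) ?raddf0//.
  by apply/hclass_eq0; exact: is_boundary0.
have [z [dz ->]] := hclass_surj v.
have [y yz] := sesp_surj S z; case: _ / yz in dz *.
have [w wy] : exists w, sesi S (n - 1) w = chd B n y.
  by apply/ses_exact; rewrite -sespd.
have dw : chd A (n - 1) w = 0.
  by apply: (@sesi_cycle _ _ _ S); rewrite wy chdK.
rewrite [X in X = 0 -> _](connecting0E dz dw wy) => /hclass_eq0/is_boundaryP[a wa].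
(* The correction is added, not subtracted, because [sesi] anticommutes with the differentials. *)
have dy : chd B n (y + sesi S n a) = 0.
  by rewrite raddfD /= sesid -wy wa subrr.
exists (hclass dy); rewrite hmapE; apply/hclass_eq.
have pa : sesp S n (sesi S n a) = 0 by apply/ses_exact; exists a.
by rewrite raddfD /= pa addr0 subrr; exact: is_boundary0.
Qed.

(** A chain [y] with differential [sesi w] both bounds [sesi w] and is a lift that defines the
    connecting map. *)
Lemma exact_at_connecting_hsesi (A B C : chcomplex) (S : ses A B C)
    (n k : int) (e : n - 1 = k) : exact_at (connecting S e) (hsesi S k).
Proof.
case: _ / e => v; split=> [|[u <-]]; last first.
  have [y [w [dy [dw [wy -> ->]]]]] : conn_spec S u (connecting0 S n u).
    by rewrite /= /conn_fun; case: cid.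
  by rewrite hmapE; apply/hclass_eq0/is_boundaryP; exists y.
have [w [dw ->]] := hclass_surj v; rewrite hmapE => /hclass_eq0/is_boundaryP[y wy].
have dy : chd C (n - 1) (sesp S n y) = 0.
  by rewrite sespd -wy; apply/ses_exact; exists w.
by exists (hclass dy); exact: connecting0E.
Qed.

Theorem corollary2p3 (R : realType) (X X' : metricType R)
    (cX : compact [set: X]) (cX' : compact [set: X'])
    (f : continuousType X X')
    (T : inv_seq R) (p : forall i, X -> sdom T i) (p' : forall i, X' -> scod T i)
    (expansion : is_strong_ANR_expansion f p p') (n : int) :
  [/\ exact_at (sigma_star T n) (del_star T n),
      exact_at (del_star T n) (E_star T (n - 1)) &
      exact_at (E_star T (n - 1)) (sigma_star T (n - 1))].
Proof.
split.
- exact: exact_at_hsesi_hsesp.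
- exact: exact_at_hsesp_connecting.
- exact: exact_at_connecting_hsesi.
Qed.
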